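(* Let $r\ge 1$ and $s\ge 2$ be integers, $q\ge 2$ a prime power, and $n\ge 0$ an integer. Write $\mathrm{P}_m=q^{\binom{r+m}{r}-1}\,\frac{1-q^{-\binom{r-1+m}{r-1}}}{1-q^{-1}}$ for $m\ge 0$, and let $\mathrm{S}_n=\#S_{r,n,s}(\mathbb{F}_q)$ and $\mathrm{Q}_n=\#Q_{r,n,s}(\mathbb{F}_q)$. Then $$\mathrm{S}_n=\sum_{\substack{0\le i\le n/s\\ j\in M_i}}(-1)^{|j|}\,\mathrm{P}_{j_1}\mathrm{P}_{j_2}\cdots\mathrm{P}_{j_{|j|}}\,\mathrm{P}_{n-is},$$ $$\mathrm{Q}_n=-\sum_{\substack{1\le i\le n/s\\ j\in M_i}}(-1)^{|j|}\,\mathrm{P}_{j_1}\mathrm{P}_{j_2}\cdots\mathrm{P}_{j_{|j|}}\,\mathrm{P}_{n-is}.$$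
   Context: $\mathbb{F}_q$ is the finite field with $q$ elements. Fix a monomial order (say degree-lexicographic) on $\mathbb{F}_q[x_1,\dots,x_r]$; a polynomial is monic if its leading coefficient is $1$. $P_{r,n}(\mathbb{F}_q)$ is the set of monic polynomials in $\mathbb{F}_q[x_1,\dots,x_r]$ of total degree exactly $n$ (its cardinality is $\mathrm{P}_n$). A polynomial is $s$-powerful if it is divisible by the $s$th power of some nonconstant polynomial, and $s$-powerfree otherwise. $Q_{r,n,s}(\mathbb{F}_q)$ is the set of $s$-powerful polynomials in $P_{r,n}(\mathbb{F}_q)$ and $S_{r,n,s}(\mathbb{F}_q)=P_{r,n}(\mathbb{F}_q)\setminus Q_{r,n,s}(\mathbb{F}_q)$. For a positive integer $i$, $M_i$ is the set of compositions of $i$, i.e. finite sequences $j=(j_1,\dots,j_{|j|})$ of positive integers with $j_1+\dots+j_{|j|}=i$, where $|j|$ is the length; $M_0$ consists of the empty sequence only, of length $0$ and with empty product $1$. *)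

(* Defs.v *)
From mathcomp Require Import all_boot all_order all_algebra.
From mathcomp Require Import finmap boolp classical_sets functions cardinality.
From mathcomp Require Import fsbigop.
From mathcomp Require Import mpoly.

Set Implicit Arguments.
Unset Strict Implicit.
Unset Printing Implicit Defensive.

Import GRing.Theory.
Local Open Scope classical_set_scope.
Local Open Scope ring_scope.

(* [mlead] is taken for the order of mpoly.v on monomials, which is
   degree-lexicographic; [msize f] is the total degree plus one for f != 0,
   and [msize 0 = 0]. *)
Definition Pset (F : finFieldType) (r n : nat) : set {mpoly F[r]} :=
  [set f | msize f = n.+1 /\ mleadc f = 1].
Arguments Pset : clear implicits.

Definition nonconstant (F : finFieldType) (r : nat) (g : {mpoly F[r]}) : Prop :=
  ~ exists c : F, g = c%:MP.

Definition mdvd (F : finFieldType) (r : nat) (d f : {mpoly F[r]}) : Prop :=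
  exists h : {mpoly F[r]}, f = h * d.

Definition powerful (F : finFieldType) (r s : nat) (f : {mpoly F[r]}) : Prop :=
  exists g : {mpoly F[r]}, nonconstant g /\ mdvd (g ^+ s) f.

Definition Qset (F : finFieldType) (r n s : nat) : set {mpoly F[r]} :=
  Pset F r n `&` [set f | powerful s f].
Arguments Qset : clear implicits.

Definition Sset (F : finFieldType) (r n s : nat) : set {mpoly F[r]} :=
  Pset F r n `\` Qset F r n s.
Arguments Sset : clear implicits.

(* [fset_set A] is the finite set with the elements of [A] only when [A] is
   finite; [finite_Pset], [finite_Qset] and [finite_Sset] cover its uses here. *)
Definition numS (F : finFieldType) (r n s : nat) : nat :=
  #|` fset_set (Sset F r n s)|.

Definition numQ (F : finFieldType) (r n s : nat) : nat :=
  #|` fset_set (Qset F r n s)|.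

Definition Pval (q r m : nat) : rat :=
  q%:R ^+ ('C(r + m, r) - 1) *
    ((1 - q%:R ^- 'C(r - 1 + m, r - 1)) / (1 - q%:R^-1)).

Definition compositions (i : nat) : set (seq nat) :=
  [set j | (forall k, k \in j -> (0 < k)%N) /\ sumn j = i].

Lemma finite_Pset (F : finFieldType) (r n : nat) : finite_set (Pset F r n).
Proof.
pose T : finType := {ffun 'X_{1..r < n.+1} -> F}.
pose poly_of (c : T) : {mpoly F[r]} := \sum_m c m *: 'X_[m].
apply: (@sub_finite_set _ _ (poly_of @` [set: T])); last first.
  exact/finite_image/finite_finset.
move=> f [szf _]; exists [ffun m : 'X_{1..r < n.+1} => f@_m] => //.
rewrite /poly_of [RHS](@mpolywE _ _ n.+1) ?szf //.
by apply: eq_bigr => m _; rewrite ffunE.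
Qed.

Lemma finite_Qset (F : finFieldType) (r n s : nat) : finite_set (Qset F r n s).
Proof. by apply: sub_finite_set (@finite_Pset F r n) => f []. Qed.

Lemma finite_Sset (F : finFieldType) (r n s : nat) : finite_set (Sset F r n s).
Proof. by apply: sub_finite_set (@finite_Pset F r n) => f []. Qed.

(* The sums [\sum_(j \in compositions i) _] drop no term: such a sum is 0 by
   convention only if infinitely many of its terms are nonzero. *)
Lemma finite_compositions (i : nat) : finite_set (compositions i).
Proof.
apply: (@sub_finite_set _ _
  ((fun b : i.-bseq 'I_i.+1 => map val b) @` [set: i.-bseq 'I_i.+1])); last first.
  exact/finite_image/finite_finset.
move=> j [jpos jsum].
have szj : (size j <= i)%N.
  rewrite -jsum; elim: j jpos {jsum} => //= k j IH jpos.
  rewrite -add1n leq_add ?jpos ?mem_head //.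
  by apply: IH => l lj; apply: jpos; rewrite inE lj orbT.
have lej k : k \in j -> (k <= i)%N.
  rewrite -jsum; elim: j {jpos jsum szj} => //= l j IH; rewrite inE.
  by case/orP=> [/eqP->|/IH kj]; [exact: leq_addr | exact: leq_trans kj (leq_addl _ _)].
have szb : (size [seq (inord k : 'I_i.+1) | k <- j] <= i)%N by rewrite size_map.
exists (Bseq szb) => //=; rewrite -map_comp -[RHS]map_id.
by apply/eq_in_map => k /lej ki /=; rewrite inordK.
Qed.

(* Main.v *)
(* Every monic f factors uniquely as f = g^s h with g monic and h monic and
   s-powerfree, so P_n = sum_(i <= n/s) P_i S_(n-is). The signed sum over the
   compositions of i is the i-th coefficient of 1 / (sum_i P_i X^i), so it inverts
   this convolution. Uniqueness of the factorization rests on unique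
   factorization in F[x_1, ..., x_r], obtained from Gauss's lemma by induction on r. *)
Require Import Defs.
From mathcomp Require Import all_boot all_order all_algebra.
From mathcomp Require Import finmap boolp classical_sets functions cardinality.
From mathcomp Require Import fsbigop.
From mathcomp Require Import mpoly.

Set Implicit Arguments.
Unset Strict Implicit.
Unset Printing Implicit Defensive.

Import GRing.Theory Num.Theory.
Local Open Scope classical_set_scope.
Local Open Scope ring_scope.

(** * Divisibility, prime elements and prime factorizations in an integral domain *)

Section Factorial.
Variable R : idomainType.
Implicit Types a b c d p u : R.

(* Divisibility in the ring itself; the [%|] of polydiv.v is pseudo-divisibility,
   which ignores nonzero constant factors. *)
Definition rdvd d a : Prop := exists h, a = h * d.

Definition prime_elt p : Prop :=
  [/\ p != 0, p \isn't a GRing.unit &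
      forall a b, rdvd p (a * b) -> rdvd p a \/ rdvd p b].

(** The factors are prime, not merely irreducible, so the existence of a factorization carries its
    uniqueness with it. *)
Definition factorization a u (l : seq R) : Prop :=
  [/\ u \is a GRing.unit, forall p, p \in l -> prime_elt p
    & a = u * \prod_(p <- l) p].

Definition factorable a : Prop := exists u l, factorization a u l.

Lemma rdvdMl d a b : rdvd d b -> rdvd d (a * b).
Proof. by case=> h ->; exists (a * h); rewrite mulrA. Qed.

Lemma rdvdMr d a b : rdvd d a -> rdvd d (a * b).
Proof. by rewrite mulrC; apply: rdvdMl. Qed.

Lemma rdvdD d a b : rdvd d a -> rdvd d b -> rdvd d (a + b).
Proof. by case=> h -> [k ->]; exists (h + k); rewrite mulrDl. Qed.

Lemma rdvdDr d a b : rdvd d a -> rdvd d (a + b) -> rdvd d b.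
Proof.
by case=> h -> [k hk]; exists (k - h); rewrite mulrBl -hk [_ + b]addrC addrK.
Qed.

Lemma rdvd0 d : rdvd d 0.
Proof. by exists 0; rewrite mul0r. Qed.

Lemma rdvd_sum d (I : Type) (s : seq I) (P : pred I) (G : I -> R) :
  (forall i, P i -> rdvd d (G i)) -> rdvd d (\sum_(i <- s | P i) G i).
Proof. by move=> dG; elim/big_ind: _ => //; [exact: rdvd0 | exact: rdvdD]. Qed.

Lemma prime_rdvd_unit p u : prime_elt p -> u \is a GRing.unit -> ~ rdvd p u.
Proof. by case=> _ /negP pnu _ + [h uE]; rewrite uE unitrM => /andP[]. Qed.

Lemma prime_rdvd_prod p (l : seq R) : prime_elt p ->
  rdvd p (\prod_(a <- l) a) -> exists2 a, a \in l & rdvd p a.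
Proof.
move=> pp; elim: l => [|a l IH]; rewrite ?big_nil ?big_cons.
  by move/(prime_rdvd_unit pp (unitr1 R)).
have [_ _ pP] := pp; case/pP=> [pa|/IH[b bl pb]]; first by exists a; rewrite ?mem_head.
by exists b => //; rewrite inE bl orbT.
Qed.

Lemma prime_rdvdX p a n : prime_elt p -> rdvd p (a ^+ n) -> rdvd p a.
Proof.
move=> pp; elim: n => [/(prime_rdvd_unit pp (unitr1 R))//|n IH].
by have [_ _ pP] := pp; rewrite exprS => /pP[].
Qed.

Lemma factorable_unit u : u \is a GRing.unit -> factorable u.
Proof. by exists u, [::]; split; rewrite ?big_nil ?mulr1. Qed.

Lemma factorable_prime p : prime_elt p -> factorable p.
Proof.
exists 1, [:: p]; split; rewrite ?unitr1 ?big_seq1 ?mul1r //.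
by move=> a; rewrite inE => /eqP->.
Qed.

Lemma factorableM a b : factorable a -> factorable b -> factorable (a * b).
Proof.
case=> [u [l [uu lp ->]]] [v [k [vu kp ->]]].
exists (u * v), (l ++ k); split; first by rewrite unitrM uu.
  by move=> p; rewrite mem_cat => /orP[/lp|/kp].
by rewrite big_cat mulrACA.
Qed.

Lemma factorable_ind (P : R -> Prop) :
  (forall u, u \is a GRing.unit -> P u) ->
  (forall p a, prime_elt p -> P a -> P (a * p)) ->
  forall a, factorable a -> P a.
Proof.
move=> Pu PM a [u [l [uu + ->]]]; elim: l => [|p l IH] lp.
  by rewrite big_nil mulr1; apply: Pu.
rewrite big_cons [p * _]mulrC mulrA; apply: PM; first by apply: lp; rewrite mem_head.
by apply: IH => b bl; apply: lp; rewrite inE bl orbT.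
Qed.

(** The prime [p] divides some prime [q] of the list and is then associate to it: drop [q] and
    absorb the quotient into the unit. The shorter list is the induction measure in
    [primitive_part]. *)
Lemma factorization_cancel p a u l : prime_elt p -> factorization (a * p) u l ->
  exists v k, factorization a v k /\ (size k < size l)%N.
Proof.
move=> pp [uu lp apE]; have [p0 /negP pnu pP] := pp.
have : rdvd p (u * \prod_(b <- l) b) by rewrite -apE; exists a.
case/pP=> [/(prime_rdvd_unit pp uu)//|/(prime_rdvd_prod pp)[q ql [h qE]]].
have [q0 _ qP] := lp q ql.
(* Since [q = h * p] is prime, it divides [h] or [p]. The first makes [p] a unit, which is excluded;
   the second makes [h] one. *)
have hu : h \is a GRing.unit.
  have : rdvd q (h * p) by rewrite -qE; exists 1; rewrite mul1r.
  case/qP=> [[k hE]|[k pE]].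
    have : h * (k * p) = h * 1 by rewrite mulr1 mulrCA -qE -hE.
    have h0 : h != 0 by apply: contraNneq q0 => h0; rewrite qE h0 mul0r.
    by move/(mulfI h0) => kp; case: pnu; apply/unitrPr; exists k; rewrite mulrC.
  apply/unitrPr; exists k; apply: (mulIf q0).
  by rewrite mul1r -mulrA -pE.
exists (u * h), (rem q l); split; last by rewrite size_rem // ltn_predL; case: (l) ql.
split; first by rewrite unitrM uu.
  by move=> b /mem_rem/lp.
apply: (mulIf p0); rewrite apE (perm_big _ (perm_to_rem ql)) big_cons.
by set P := \prod_(_ <- _) _; rewrite /= qE -!mulrA (mulrC p).
Qed.
End Factorial.

(** * Gauss's lemma, and the passage of prime factorization from R to R[x] *)

Section Gauss.
Variable R : idomainType.
Implicit Types (f g h : {poly R}).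

Lemma rdvd_polyC (p : R) f : rdvd p%:P f <-> forall i, rdvd p f`_i.
Proof.
split=> [[h ->] i|pf]; first by rewrite coefMC; exists h`_i.
have [h hE] := choice pf; exists (\poly_(i < size f) h i).
apply/polyP => i; rewrite coefMC coef_poly; case: ltnP => [_|fi].
  exact: hE.
by rewrite mul0r nth_default.
Qed.

(** If [p] divides neither factor, take in each the first coefficient not divisible by [p], at
    indices [i] and [j]. In the coefficient of the product at [i + j], every term except the product
    of these two is a multiple of [p]. *)
Lemma prime_polyC (p : R) : prime_elt p -> prime_elt p%:P.
Proof.
move=> [p0 pnu pP]; split; first by rewrite polyC_eq0.
  by rewrite poly_unitE size_polyC p0 coefC.
have ex_coef f : ~ rdvd p%:P f -> exists i,
    ~ rdvd p f`_i /\ forall k, (k < i)%N -> rdvd p f`_k.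
  move=> pf; have : exists i, ~~ `[< rdvd p f`_i >].
    by apply: contrapT => /forallNP nex; apply: pf; apply/rdvd_polyC => i;
       apply/asboolP/negPn/negP/nex.
  move=> ex; case: (ex_minnP ex) => i /asboolP ip imin; exists i; split=> // k ki.
  by apply/asboolP/negPn/negP => /imin; rewrite leqNgt ki.
move=> f g pfg; apply: contrapT => /not_orP[/ex_coef[i [pi ilt]] /ex_coef[j [pj jlt]]].
have /pP[]// : rdvd p (f`_i * g`_j).
have ij : (i < (i + j).+1)%N by rewrite ltnS leq_addr.
have /rdvd_polyC/(_ (i + j)%N) := pfg.
rewrite coefM (bigD1 (Ordinal ij)) //= addKn addrC; apply: rdvdDr.
apply: rdvd_sum => k ki; case: (ltngtP k i) => [/ilt|ik|kE].
- exact: rdvdMr.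
- apply/rdvdMl/jlt; rewrite ltn_subLR ?ltn_add2r //; exact: (ltn_ord k).
- by case/eqP: ki; apply: val_inj.
Qed.

Lemma factorable_polyC (a : R) : factorable a -> factorable a%:P.
Proof.
move=> af; pattern a; apply: factorable_ind af => [u uu|p b pp bf].
  by apply: factorable_unit; apply: rmorph_unit.
by rewrite polyCM; apply/factorableM/factorable_prime/prime_polyC.
Qed.

(** The content-one condition, expressed by prime divisors rather than by a gcd of the
    coefficients. *)
Definition primitive f : Prop := forall p : R, prime_elt p -> ~ rdvd p%:P f.

Hypothesis factR : forall a : R, a != 0 -> factorable a.

(** Dividing out a constant prime removes one prime from the leading coefficient, so the process
    stops. *)
Lemma primitive_part f : f != 0 ->
  exists c g, [/\ f = g * c%:P, primitive g, c != 0 & size g = size f].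
Proof.
move=> f0; have : lead_coef f != 0 by rewrite lead_coef_eq0.
move/factR=> [u [l]]; have [n] := ubnP (size l).
elim: n => // n IH in f f0 u l *; rewrite ltnS => ln fl.
case: (pselect (primitive f)) => [fp|].
  by exists 1, f; rewrite mulr1 oner_eq0.
rewrite /primitive -existsNE => -[p /not_implyP[pp /contrapT[h fE]]].
have [p0 _ _] := pp.
have h0 : h != 0 by apply: contraNneq f0 => h0; rewrite fE h0 mul0r.
move: fl; rewrite fE lead_coefM lead_coefC.
case/(factorization_cancel pp) => v [k [hv kl]].
have [c [g [hE gp c0 gs]]] := IH h h0 v k (leq_trans kl ln) hv.
exists (c * p), g; split=> //; rewrite ?mulf_neq0 //.
  by rewrite hE polyCM mulrA.
by rewrite gs (mulrC h) size_Cmul.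
Qed.

(** By Gauss's lemma each prime of [c] divides [g] or [h] and can be cancelled there without
    changing degrees. This turns a splitting up to a constant into one in R[x]. *)
Lemma mulC_split (c : R) f g h : c != 0 -> f != 0 -> f * c%:P = g * h ->
  exists g' h', [/\ f = g' * h', size g' = size g & size h' = size h].
Proof.
move=> /factR cf; move: c cf f g h.
apply: (factorable_ind (P := fun c => forall f g h, f != 0 -> f * c%:P = g * h ->
  exists g' h', [/\ f = g' * h', size g' = size g & size h' = size h])).
  move=> u uu f g h f0 fE; exists g, (h * u^-1%:P); split=> //.
    by rewrite mulrA -fE -mulrA -polyCM divrr // mulr1.
  by rewrite mulrC size_Cmul // invr_eq0; apply: contraTneq uu => ->; rewrite unitr0.
move=> p a pp IH f g h f0; have [p0 _ _] := pp.
have P0 : p%:P != 0 by rewrite polyC_eq0.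
rewrite polyCM mulrA => fE; have [_ _] := prime_polyC pp.
move/(_ g h); rewrite -fE; case; first by exists (f * a%:P).
  move=> [k gE]; move: fE; rewrite gE [RHS]mulrAC => /(mulIf P0)/(IH _ _ _ f0).
  by rewrite [k * p%:P]mulrC size_Cmul.
move=> [k hE]; move: fE; rewrite hE mulrA => /(mulIf P0)/(IH _ _ _ f0).
by rewrite [k * p%:P]mulrC size_Cmul.
Qed.

(** A constant prime dividing [h * f] must divide [h], because [f] is primitive; so [c] cancels
    prime by prime. *)
Lemma primitive_rdvd (c : R) f g : primitive f -> c != 0 ->
  rdvd f (g * c%:P) -> rdvd f g.
Proof.
move=> fp /factR cf; move: c cf g.
apply: (factorable_ind (P := fun c => forall g, rdvd f (g * c%:P) -> rdvd f g)).
  move=> u uu g [h gE]; exists (h * u^-1%:P).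
  by rewrite mulrAC -gE -mulrA -polyCM divrr // mulr1.
move=> p a pp IH g [h gE]; apply: IH; have [p0 _ pP] := prime_polyC pp.
have : rdvd p%:P (h * f) by rewrite -gE polyCM mulrA; exists (g * a%:P).
case/pP => [[k hE]|/(fp _ pp)//].
exists k; apply: (mulIf p0).
by move: gE; rewrite polyCM mulrA => ->; rewrite hE mulrAC.
Qed.

Import Pdiv.Idomain.

(* Pseudo-division in R[x] replaces division over the fraction field of R; for a
   primitive divisor it amounts to divisibility in R[x]. *)
Lemma primitive_dvdp f g : primitive f -> f %| g -> rdvd f g.
Proof.
move=> fp /dvdpP[[c h] /= c0 gE]; apply: (primitive_rdvd fp c0).
by exists h; rewrite mulrC mul_polyC.
Qed.

Lemma rdvd_dvdp f g : rdvd f g -> f %| g.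
Proof. by case=> h ->; apply: dvdp_mull. Qed.

(** Irreducibility refers to pseudo-divisibility, as over the fraction field. There [f] is either
    coprime to [g], hence divides [h], or divides [g]; primitivity brings the conclusion back to
    R[x]. *)
Lemma primitive_irreducible_prime f :
  primitive f -> irreducible_poly f -> prime_elt f.
Proof.
move=> fp fi; split; first exact: irredp_neq0.
  by rewrite poly_unitE; case: (size f) fi.1 => [|[|]].
move=> g h /rdvd_dvdp fgh.
have [cop|] := boolP (coprimep f g).
  by right; apply: primitive_dvdp => //; rewrite Gauss_dvdpr in fgh.
case/(coprimepPn _ (irredp_neq0 fi)) => d /andP[].
rewrite dvdp_gcd => /andP[df dg] d1; left; apply: primitive_dvdp => //.
have /fi/(_ df) : size d != 1 by rewrite size_poly_eq1.
by move/eqp_dvdl <-.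
Qed.

(** Induction on the degree. The content factors in R; the primitive part is a constant, a prime, or
    a product of two polynomials of smaller degree. *)
Lemma factorable_poly f : f != 0 -> factorable f.
Proof.
have [n] := ubnP (size f); elim: n => // n IH in f *; rewrite ltnS => fn f0.
have [c [g [fE gp c0 gs]]] := primitive_part f0.
rewrite fE; apply: factorableM; last exact/factorable_polyC/factR.
have g0 : g != 0 by rewrite -size_poly_eq0 gs size_poly_eq0.
rewrite -{}gs in fn.
have [g1|g1] := leqP (size g) 1.
  have gE := size1_polyC g1; rewrite gE; apply/factorable_polyC/factR.
  by rewrite -polyC_eq0 -gE.
case: (pselect (irreducible_poly g)) => [gi|gni].
  exact/factorable_prime/primitive_irreducible_prime.
have : exists d : {poly R}, [/\ size d != 1, d %| g & ~~ (d %= g)].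
  apply: contrapT => nex; apply: gni; split=> // d d1 dg.
  by apply: contrapT => /negP ndg; apply: nex; exists d.
case=> d [d1 dg ndg]; case/dvdpP: (dg) => -[a e] /= a0 gE.
have : e * d != 0 by rewrite -gE scale_poly_eq0 negb_or a0.
rewrite mulf_eq0 negb_or => /andP[e0 d0].
have lt_dg : (size d < size g)%N.
  rewrite ltn_neqAle dvdp_leq // andbT.
  by rewrite -(dvdp_size_eqp dg) in ndg.
(* Pseudo-division splits [g] only up to the constant [a], which [mulC_split] removes. *)
have : g * a%:P = e * d by rewrite mulrC mul_polyC.
case/(mulC_split a0 g0) => e' [d' [gE' se sd]].
have e'0 : e' != 0 by rewrite -size_poly_eq0 se size_poly_eq0.
have d'0 : d' != 0 by rewrite -size_poly_eq0 sd size_poly_eq0.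
rewrite gE'; apply: factorableM; apply: IH => //; last first.
  by rewrite sd; apply: leq_trans fn.
(* As [d] is nonzero and not of size 1, it has positive degree, so the cofactor has smaller degree
   than [g]. *)
apply: leq_trans fn; rewrite gE' size_mul // sd.
case: (size d) d1 (size_poly_gt0 d) => [|[|m]]; rewrite ?d0 // => _ _.
by rewrite !addnS /= ltnS leq_addr.
Qed.
End Gauss.

(** * Transfer along isomorphisms, and factorization in several variables *)

Lemma factorable_can (R S : idomainType) (f : {rmorphism R -> S})
    (g : {rmorphism S -> R}) (fK : cancel f g) (gK : cancel g f) (a : S) :
  factorable (g a) -> factorable a.
Proof.
have prime_f p : prime_elt p -> prime_elt (f p).
  move=> [p0 pnu pP]; split.
  - by apply: contraNneq p0 => fp0; rewrite -(fK p) fp0 rmorph0.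
  - by apply: contra pnu => /(rmorph_unit g); rewrite fK.
  move=> b c [h hE]; have : rdvd p (g b * g c).
    by exists (g h); rewrite -rmorphM hE rmorphM fK.
  by case/pP => -[k kE]; [left|right]; exists (f k); rewrite -rmorphM -kE gK.
rewrite -{2}(gK a) => af; move: (g a) af => {a}.
apply: factorable_ind => [u /(rmorph_unit f)/factorable_unit //|p b pp IH].
by rewrite rmorphM; apply/factorableM/factorable_prime/prime_f.
Qed.

Section UniIso.
Variables (R : idomainType) (n : nat).

(** Evaluation at the last variable; with [muni] it identifies polynomials in n + 1 variables with
    univariate polynomials over those in n variables, which drives the induction on the number of
    variables. *)
Let muni_inv : {rmorphism {poly {mpoly R[n]}} -> {mpoly R[n.+1]}} :=
  horner_eval ('X_ord_max : {mpoly R[n.+1]}) \o map_poly (@mwiden n R).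

Lemma muni_invZXn (p : {mpoly R[n]}) k :
  muni_inv (p *: 'X^k) = mwiden p * 'X_ord_max ^+ k.
Proof. by rewrite /= map_polyZ map_polyXn /horner_eval hornerZ hornerXn. Qed.

Lemma muni_mpolyX (m : 'X_{1..n.+1}) : muni ('X_[m] : {mpoly R[n.+1]}) =
  'X_[[multinom m (widen_ord (leqnSn n) i) | i < n]] *: 'X^(m ord_max).
Proof. by rewrite muniE msuppX big_seq1 mcoeffX eqxx scale1r. Qed.

Lemma muni_mwiden (p : {mpoly R[n]}) : muni (mwiden p) = p%:P.
Proof.
elim/mpolyind: p => [|c m p _ _ IH]; first by rewrite mwiden0 muni0.
rewrite mwidenD mwidenZ mwidenX muniD muniZ muni_mpolyX IH polyCD; congr (_ + _).
rewrite mnmwiden_ordmax expr0 -mul_mpolyC polyCM -!mul_polyC mulr1.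
congr (_ * ('X_[_])%:P); apply/mnmP => i.
by rewrite mnmE mnmwiden_widen.
Qed.

Lemma muni_invK : cancel muni_inv (@muni n R).
Proof.
move=> p; rewrite -[p]coefK poly_def !rmorph_sum; apply: eq_bigr => k _.
rewrite muni_invZXn rmorphM rmorphXn /= muni_mwiden.
rewrite muni_mpolyX mnm1E eqxx mul_polyC; congr (_ *: _ ^+ _).
rewrite (_ : [multinom _ | _ < _] = 0%MM) ?mpolyX0 ?scale1r //.
by apply/mnmP => i; rewrite mnmE mnm0E mnm1E -val_eqE /= gtn_eqF.
Qed.

Lemma muniK : cancel (@muni n R) muni_inv.
Proof.
elim/mpolyind => [|c m p _ _ IH]; first by rewrite !rmorph0.
rewrite muniD rmorphD IH muniZ muni_mpolyX scalerA muni_invZXn; congr (_ + _).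
rewrite mwidenM mwidenC mwidenX -mulrA mul_mpolyC mpolyXn -mpolyXD.
congr (_ *: 'X_[_]); apply/mnmP => i; rewrite mnmDE mulmnE mnm1E.
case: (unliftP ord_max i) => [j|] ->.
  have -> : lift ord_max j = widen_ord (leqnSn n) j by apply: val_inj; exact: lift_max.
  by rewrite mnmwiden_widen mnmE -val_eqE /= gtn_eqF ?muln0 ?addn0.
by rewrite mnmwiden_ordmax eqxx mul1n.
Qed.
End UniIso.

Lemma factorable_mpoly (F : fieldType) n (f : {mpoly F[n]}) : f != 0 -> factorable f.
Proof.
elim: n f => [|n IH] f f0.
  (* Without variables the only monomial is 1, so [f] is a nonzero constant. *)
  apply: factorable_unit.
  have fE : f = (f@_0)%:MP.
    by apply/mpolyP => m; rewrite mcoeffC (_ : m = 0%MM) ?eqxx ?mulr1 //; apply/mnmP => -[].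
  by rewrite fE rmorph_unit // unitfE -(mpolyC_eq0 0) -fE.
apply: (factorable_can (@muni_invK F n) (@muniK F n)).
apply: factorable_poly => //.
by rewrite (can2_eq (@muniK F n) (@muni_invK F n)) rmorph0.
Qed.

(** * Uniqueness of the power part, up to units *)

Section PowerFactor.
Variable R : idomainType.
Implicit Types a g h p : R.

Definition powerfree_elt (s : nat) h : Prop :=
  forall d, rdvd (d ^+ s) h -> d \is a GRing.unit.

(** The factors [p] are moved into [h] one at a time, since none of them can divide [g]. *)
Lemma prime_power_Gauss p g h n : prime_elt p -> ~ rdvd p g ->
  rdvd (p ^+ n) (g * h) -> rdvd (p ^+ n) h.
Proof.
move=> pp pg; have [p0 _ pP] := pp.
elim: n h => [|n IH] h; first by exists h; rewrite expr0 mulr1.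
case=> k; rewrite exprSr mulrA => ghE; have : rdvd p (g * h).
  by exists (k * p ^+ n).
case/pP=> [/pg//|[h1 hE]]; move: ghE; rewrite hE mulrA => /(mulIf p0) gh1E.
have [|h2 ->] := IH h1; first by exists k.
by exists h2; rewrite mulrA.
Qed.

(* Remove the primes of g one at a time: a prime of g either divides g', and cancels,
   or its s-th power divides h', which is s-powerfree. *)
Lemma powerfree_factor_uniq s g g' h h' : factorable g ->
  powerfree_elt s h -> powerfree_elt s h' -> g ^+ s * h = g' ^+ s * h' ->
  exists2 u, u \is a GRing.unit & g' = u * g.
Proof.
move=> gf hf h'f; move: g gf g'; apply: factorable_ind => [u uu|p a pp IH] g' ghE.
  exists (g' / u); last by rewrite divrK.
  rewrite unitrM unitrV uu andbT; apply: hf; exists (h' / u ^+ s).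
  by rewrite mulrAC (mulrC h') -ghE mulrAC divrr ?unitrX ?mul1r.
have [p0 /negP pnu _] := pp.
case: (pselect (rdvd p g')) => [[b g'E]|pg'].
  have : a ^+ s * h = b ^+ s * h'.
    apply: (mulIf (expf_neq0 s p0)).
    by rewrite mulrAC -exprMn ghE g'E exprMn mulrAC.
  by case/IH => u uu bE; exists u; rewrite // g'E bE mulrA.
case: pnu; apply: h'f; apply: (prime_power_Gauss (g := g' ^+ s)) => //.
  by move/(prime_rdvdX pp).
by rewrite -ghE exprMn; apply/rdvdMr; apply/rdvdMl; exists 1; rewrite mul1r.
Qed.
End PowerFactor.

(** * The factorization of a monic polynomial into a power and a powerfree part *)

Section Monic.
Variables (F : finFieldType) (r s : nat).
Hypothesis s_gt0 : (0 < s)%N.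
Implicit Types f g h : {mpoly F[r]}.

(** The units are the nonzero constants. The remaining constant 0 is excluded because its s-th power
    divides only 0. *)
Lemma powerfreeP h : h != 0 -> ~ powerful s h <-> powerfree_elt s h.
Proof.
move=> h0; split=> [hf d dh|hf [g [gn /hf gu]]].
  have [c dE] : exists c, d = c%:MP by apply: contrapT => dn; apply: hf; exists d.
  rewrite dE rmorph_unit // unitfE; apply: contraNneq h0 => c0.
  by case: dh => k ->; rewrite dE c0 expr0n gtn_eqF // mulr0.
by apply: gn; exists (g@_0); case/andP: gu => /eqP.
Qed.

Lemma mleadc_neq0 f : mleadc f = 1 -> f != 0.
Proof. by move=> f1; rewrite -mleadc_eq0 f1 oner_eq0. Qed.

Lemma mleadcM_idomain f g : mleadc (f * g) = mleadc f * mleadc g.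
Proof.
have [->|f0] := eqVneq f 0; first by rewrite mul0r mleadc0 mul0r.
have [->|g0] := eqVneq g 0; first by rewrite mulr0 mleadc0 mulr0.
by rewrite mleadcM_proper // mulf_neq0 // mleadc_eq0.
Qed.

Lemma mleadcX_idomain f n : mleadc (f ^+ n) = mleadc f ^+ n.
Proof. by elim: n => [|n IH]; rewrite ?mleadc1 // !exprS mleadcM_idomain IH. Qed.

Lemma Pset_powerM g h i j : Pset F r i g -> Pset F r j h ->
  Pset F r (i * s + j) (g ^+ s * h).
Proof.
case=> gi g1 [hj h1]; split; last by rewrite mleadcM_idomain mleadcX_idomain g1 h1 expr1n mulr1.
have g0 := mleadc_neq0 g1; have h0 := mleadc_neq0 h1.
have gs0 := expf_neq0 s g0.
rewrite -mlead_deg ?mulf_neq0 // mleadM // mleadX // mdegD mdegMn.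
by congr ((_ * _ + _).+1); apply: succn_inj; rewrite mlead_deg.
Qed.

(** The unit relating [g] and [g'] is a constant, and comparing leading coefficients shows that it
    is 1. *)
Lemma monic_power_uniq g g' h h' :
  mleadc g = 1 -> mleadc g' = 1 -> mleadc h = 1 -> mleadc h' = 1 ->
  ~ powerful s h -> ~ powerful s h' -> g ^+ s * h = g' ^+ s * h' ->
  g = g' /\ h = h'.
Proof.
move=> g1 g'1 h1 h'1 hf h'f ghE; have g0 := mleadc_neq0 g1.
have gg' : g = g'.
  have [||u /andP[/eqP-> _] g'E] := powerfree_factor_uniq (factorable_mpoly g0) _ _ ghE.
  - by apply/powerfreeP => //; apply: mleadc_neq0.
  - by apply/powerfreeP => //; apply: mleadc_neq0.
  by move: g'1; rewrite g'E mul_mpolyC mleadcZE g1 mulr1 => ->; rewrite scale1r.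
split=> //; apply: (mulfI (expf_neq0 s g0)).
by rewrite ghE gg'.
Qed.

(** Pull out s-th powers of nonconstant polynomials while there are any; each one lowers the total
    degree of the cofactor. *)
Lemma power_factor f : f != 0 ->
  exists g h, f = g ^+ s * h /\ ~ powerful s h.
Proof.
have [n] := ubnP (msize f); elim: n f => // n IH f; rewrite ltnS => fn f0.
case: (pselect (powerful s f)) => [|ff]; last by exists 1, f; rewrite expr1n mul1r.
case=> g [gn [k fE]]; move: f0; rewrite fE mulf_eq0 negb_or => /andP[k0 gs0].
have g0 : g != 0 by apply: contraNneq gs0 => ->; rewrite expr0n gtn_eqF.
have [|//|g1 [h [kE hf]]] := IH k.
  apply: leq_trans fn; rewrite fE -mlead_deg // -mlead_deg ?mulf_neq0 //.
  rewrite !ltnS mleadM // mdegD mleadX // mdegMn -[X in (X < _)%N]addn0 ltn_add2l.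
  rewrite muln_gt0 s_gt0 andbT lt0n; apply/negP => /eqP g00; apply: gn.
  by exists (g@_0); apply: msize1_polyC; rewrite -mlead_deg // g00.
by exists (g1 * g), h; rewrite kE exprMn mulrAC.
Qed.

Lemma monic_power_factor n f : Pset F r n f -> exists g h i,
  [/\ (i * s <= n)%N, Pset F r i g, Sset F r (n - i * s) s h & f = g ^+ s * h].
Proof.
case=> fn f1; have f0 := mleadc_neq0 f1.
have [g [h [fE hf]]] := power_factor f0.
have : g ^+ s * h != 0 by rewrite -fE.
rewrite mulf_eq0 negb_or => /andP[gs0 h0].
have g0 : g != 0 by apply: contraNneq gs0 => ->; rewrite expr0n gtn_eqF.
pose c := mleadc g; have c0 : c != 0 by rewrite mleadc_eq0.
(* The two scalars cancel in the product, so once [g1] is monic, [h1] inherits monicity from [f]. *)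
pose g1 := c^-1 *: g; pose h1 := c ^+ s *: h.
have g1E : mleadc g1 = 1 by rewrite mleadcZE mulVf.
have fE1 : f = g1 ^+ s * h1.
  by rewrite fE exprZn -scalerAl -scalerAr scalerA exprVn mulVf ?scale1r ?expf_neq0.
have h1E : mleadc h1 = 1.
  by move: f1; rewrite fE1 mleadcM_idomain mleadcX_idomain g1E expr1n mul1r.
have Pg : Pset F r (msize g1).-1 g1.
  by split=> //; apply/mpolySpred/mleadc_neq0.
have Ph : Pset F r (msize h1).-1 h1.
  by split=> //; apply/mpolySpred/mleadc_neq0.
have [] := Pset_powerM Pg Ph; rewrite -fE1 fn => -[nE] _.
exists g1, h1, (msize g1).-1; split=> //; rewrite ?nE ?leq_addr ?addKn //.
split=> // -[_ [d [dn [k kE]]]]; apply: hf; exists d; split=> //.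
exists (c ^- s *: k); rewrite -scalerAl -kE scalerA mulVf ?scale1r //.
exact: expf_neq0.
Qed.
End Monic.

(** * Counting monic polynomials by the degree of their power part *)

Lemma mem_fset_setP (T : choiceType) (A : set T) (x : T) :
  finite_set A -> reflect (A x) (x \in (fset_set A : seq T)).
Proof.
by move=> fA; apply: (iffP idP) => xA; [move: xA; rewrite in_fset_set ?inE|
   rewrite in_fset_set ?inE].
Qed.

Definition numP (F : finFieldType) (r n : nat) : nat :=
  #|` fset_set (Pset F r n)|.

Section Counting.
Variables (F : finFieldType) (r : nat).

Let mem_Pset n (f : {mpoly F[r]}) :=  mem_fset_setP f (@finite_Pset F r n).
Let mem_Sset n s (f : {mpoly F[r]}) :=  mem_fset_setP f (@finite_Sset F r n s).
Let mem_Qset n s (f : {mpoly F[r]}) :=  mem_fset_setP f (@finite_Qset F r n s).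

(** The monic polynomials of degree [n] are sorted by the degree [i] of the base of their power
    part; each class is in bijection with the pairs [(g, h)]. *)
Lemma numP_conv n s : (0 < s)%N ->
  numP F r n = (\sum_(i < (n %/ s).+1) numP F r i * numS F r (n - i * s) s)%N.
Proof.
move=> s0.
(* [k f] is this degree, chosen for all [f] at once; it is arbitrary outside [Pset F r n]. *)
have /choice[k kP] : forall f : {mpoly F[r]}, exists i : 'I_(n %/ s).+1,
    Pset F r n f -> exists g h,
      [/\ Pset F r i g, Sset F r (n - i * s) s h & f = g ^+ s * h].
  move=> f; case: (pselect (Pset F r n f)) => [fn|nf]; last by exists ord0.
  have [g [h [i [isn gi hi fE]]]] := monic_power_factor s0 fn.
  have lti : (i < (n %/ s).+1)%N by rewrite ltnS leq_divRL.
  by exists (Ordinal lti) => _; exists g, h.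
have Sfree m h : Sset F r m s h -> mleadc h = 1 /\ ~ powerful s h.
  by move=> [hm nh]; split; [case: hm | move=> hp; apply: nh].
rewrite {1}/numP -sum1_size (partition_big k predT) //=; apply: eq_bigr => i _.
rewrite -big_filter sum1_size -(size_allpairs (fun g h => g ^+ s * h)).
apply/perm_size/uniq_perm; first by rewrite filter_uniq ?fset_uniq.
  apply: allpairs_uniq; rewrite ?fset_uniq //.
  move=> u v /allpairsP[[g h] [/mem_Pset[_ g1] /mem_Sset/Sfree[h1 hf] ->]].
  move=> /allpairsP[[g' h'] [/mem_Pset[_ g'1] /mem_Sset/Sfree[h'1 h'f] ->]] /= ghE.
  by case: (monic_power_uniq s0 g1 g'1 h1 h'1 hf h'f ghE) => /= -> ->.
move=> f; rewrite mem_filter; apply/andP/allpairsP => [[/eqP ki /mem_Pset]|].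
  case/kP=> g [h []]; rewrite ki => gi hi ->; exists (g, h); split=> //=.
    exact/mem_Pset.
  exact/mem_Sset.
case=> -[g h] /= [/mem_Pset gi /mem_Sset hi fE].
have isn : (i * s <= n)%N by rewrite -leq_divRL // -ltnS.
have fn : Pset F r n f.
  by rewrite fE -(subnKC isn); apply: Pset_powerM => //; case: hi.
split; last exact/mem_Pset.
(* The factorization chosen for [f] may differ a priori from the given one; uniqueness gives
   [g = g'], so [k f] equals [i]. *)
have [g' [h' [gi' hi' fE']]] := kP f fn.
have [g1 g'1] : mleadc g = 1 /\ mleadc g' = 1 by case: gi; case: gi'.
have [h1 hf] := Sfree _ _ hi; have [h'1 h'f] := Sfree _ _ hi'.
have [gg' _] := monic_power_uniq s0 g1 g'1 h1 h'1 hf h'f (etrans (esym fE) fE').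
by case: gi' gi => + _ [+ _]; rewrite gg' => -> [/val_inj ->].
Qed.

Lemma numPQS n s : numP F r n = (numQ F r n s + numS F r n s)%N.
Proof.
rewrite /numS /Sset fset_setD; [|exact: finite_Pset|exact: finite_Qset].
have QP : (fset_set (Qset F r n s) `<=` fset_set (Pset F r n))%fset.
  by apply/fsubsetP => f /mem_Qset[fn _]; apply/mem_Pset.
by rewrite cardfsD (fsetIidPr QP) subnKC ?fsubset_leq_card.
Qed.

(** * Counting polynomials of bounded degree, and the closed formula for [numP] *)

Definition mpoly_of_coeffs n (c : {ffun 'X_{1..r < n} -> F}) : {mpoly F[r]} :=
  \sum_m c m *: 'X_[m].

Lemma mcoeff_of_coeffs n (c : {ffun 'X_{1..r < n} -> F}) (m : 'X_{1..r < n}) :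
  (mpoly_of_coeffs c)@_m = c m.
Proof.
rewrite raddf_sum (bigD1 m) //= mcoeffZ mcoeffX eqxx mulr1 big1 ?addr0 // => k km.
by rewrite mcoeffZ mcoeffX (negPf (_ : val k != m)) ?mulr0.
Qed.

Lemma msize_leP n (f : {mpoly F[r]}) :
  (msize f <= n)%N <-> exists c : {ffun 'X_{1..r < n} -> F}, f = mpoly_of_coeffs c.
Proof.
split=> [fn|[c ->]].
  exists [ffun m : 'X_{1..r < n} => f@_m]; rewrite [LHS](mpolywE fn).
  by apply: eq_bigr => m _; rewrite ffunE.
apply: (leq_trans (msize_sum _ _ _)); apply/bigmax_leqP_seq => m _ _.
by apply: (leq_trans (msizeZ_le _ _)); rewrite msizeX bmdeg.
Qed.

Lemma finite_msize_le n : finite_set [set f : {mpoly F[r]} | (msize f <= n)%N].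
Proof.
apply: (@sub_finite_set _ _ (@mpoly_of_coeffs n @` [set: _])%classic).
  by move=> f /msize_leP[c ->]; exists c.
exact/finite_image/finite_finset.
Qed.

Lemma card_msize_le n :
  #|` fset_set [set f : {mpoly F[r]} | (msize f <= n)%N]| =
  (#|F| ^ #|{: 'X_{1..r < n}}|)%N.
Proof.
rewrite -card_ffun cardE -(size_map (@mpoly_of_coeffs n)).
apply/perm_size/uniq_perm; first exact: fset_uniq.
  rewrite map_inj_uniq ?enum_uniq // => c d cd; apply/ffunP => m.
  by rewrite -!mcoeff_of_coeffs cd.
move=> f; apply/(mem_fset_setP f (finite_msize_le n))/mapP => /= [/msize_leP[c ->]|[c _ ->]].
  by exists c; rewrite ?mem_enum.
by apply/msize_leP; exists c.
Qed.

End Counting.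

Lemma card_mdeg_eq r n d : (d < n)%N ->
  #|[pred m : 'X_{1..r.+1 < n} | mdeg m == d]| = 'C(d + r, d).
Proof.
move=> dn; rewrite -size_basis cardE -(size_map val).
apply/perm_size/uniq_perm; rewrite ?uniq_basis //.
  by rewrite map_inj_uniq ?enum_uniq //; exact: val_inj.
move=> m; rewrite -basis_cover; apply/mapP/idP => [[k + ->]|md].
  by rewrite mem_enum inE.
have mn : (mdeg m < n)%N by rewrite (eqP md).
by exists (BMultinom mn); rewrite ?mem_enum ?inE.
Qed.

(** Sum over the exact degree; the total is the hockey-stick identity, proved with Pascal's rule. *)
Lemma card_bmultinom r n : #|{: 'X_{1..r.+1 < n}}| = 'C(r + n, r.+1).
Proof.
have -> : #|{: 'X_{1..r.+1 < n}}| = (\sum_(d < n) 'C(d + r, d))%N.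
  rewrite -sum1_card (partition_big (fun m => Ordinal (bmdeg m)) predT) //=.
  apply: eq_bigr => d _; rewrite -(card_mdeg_eq r (ltn_ord d)) -sum1_card.
  by apply: eq_bigl => m; rewrite inE -val_eqE.
elim: n => [|n IH]; first by rewrite big_ord0 addn0 bin_small.
rewrite big_ord_recr /= IH addnS binS; congr (_ + _)%N.
by rewrite addnC -bin_sub ?leq_addl // addnK.
Qed.

(** A polynomial of degree at most [n] either has smaller degree (or is 0), or is a nonzero scalar
    times a monic polynomial of degree [n], in exactly one way. *)
Lemma numP_scale (F : finFieldType) r n :
  (numP F r n * #|F|.-1 + #|F| ^ #|{: 'X_{1..r < n}}| =
   #|F| ^ #|{: 'X_{1..r < n.+1}}|)%N.
Proof.
have P k (f : {mpoly F[r]}) : reflect (msize f <= k)%N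
    (f \in (fset_set [set f : {mpoly F[r]} | (msize f <= k)%N] : seq _)).
  exact: mem_fset_setP (@finite_msize_le F r k).
rewrite -!card_msize_le mulnC.
rewrite -(cardC1 (0 : F)) cardE -(size_allpairs (fun c (f : {mpoly F[r]}) => c *: f)).
rewrite -size_cat; apply/perm_size/uniq_perm; last first.
- move=> f; rewrite mem_cat; apply/orP/P => [[]|].
  + case/allpairsP => -[c g] /= [c0 /(mem_fset_setP g (finite_Pset F r n))[gn _] ->].
    by rewrite msizeZ ?gn //; move: c0; rewrite mem_enum.
  + by move/P/leqW.
  rewrite leq_eqVlt ltnS => /orP[/eqP fn|]; last first.
    by right; apply/P.
  left; have c0 : mleadc f != 0 by rewrite mleadc_eq0 -msize_poly_eq0 fn.
  apply/allpairsP; exists (mleadc f, (mleadc f)^-1 *: f); split => /=.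
  + by rewrite mem_enum.
  + apply/(mem_fset_setP _ (finite_Pset F r n)); split; first by rewrite msizeZ ?invr_eq0.
    by rewrite mleadcZE mulVf.
  + by rewrite scalerA mulfV ?scale1r.
- exact: fset_uniq.
rewrite cat_uniq fset_uniq andbT; apply/andP; split.
  apply: allpairs_uniq; rewrite ?enum_uniq ?fset_uniq // => u v.
  move=> /allpairsP[[c g] [/= c0 /(mem_fset_setP g (finite_Pset F r n))[_ g1] ->]].
  move=> /allpairsP[[d h] [/= d0 /(mem_fset_setP h (finite_Pset F r n))[_ h1] ->]].
  move=> /= E; have := congr1 (fun f => mleadc f) E.
  rewrite !mleadcZE g1 h1 !mulr1 => cd; move: E; rewrite cd.
  by move/scalerI => -> //; move: d0; rewrite mem_enum.
apply/hasPn => f /P fn; apply/negP => /allpairsP.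
case=> -[c g] /= [c0 /(mem_fset_setP g (finite_Pset F r n))[gn _] fE].
by move: fn; rewrite fE msizeZ ?gn ?ltnn //; move: c0; rewrite mem_enum.
Qed.

Lemma numP_Pval (F : finFieldType) r n : (0 < r)%N ->
  (numP F r n)%:R = Pval #|F| r n.
Proof.
case: r => // r _; have q1 : (1 < #|F|)%N := card_finNzRing_gt1 F.
rewrite /Pval subn1 /=; set q : rat := #|F|%:R.
have q0 : q != 0 by rewrite pnatr_eq0 -lt0n ltnW.
have q1' : q - 1 != 0 by rewrite subr_eq0 pnatr_eq1 gtn_eqF.
have := congr1 (fun k => k%:R : rat) (numP_scale F r.+1 n).
rewrite natrD natrM !natrX !card_bmultinom -/q -subn1 natrB 1?ltnW // -/q.
(* Pascal's rule separates the monomials of degree exactly [n] from those of smaller degree. *)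
rewrite addnS addSn binS => E.
have e0 : q ^+ 'C(r + n, r) != 0 by rewrite expf_neq0.
have -> : (r.+1 - 1 = r)%N by rewrite subn1.
(* Positivity keeps the natural subtraction in the exponent of [Pval] from truncating. *)
have : (0 < 'C(r + n, r))%N by rewrite bin_gt0 leq_addr.
move: E e0; case: ('C(r + n, r)) => // k E e0 _.
rewrite exprD in E; rewrite addnS /= exprD.
have -> : 1 - q^-1 = (q - 1) / q by rewrite mulrBl divff // mul1r.
rewrite invf_div !mulrA; apply: (canRL (mulfK q1')).
rewrite (canRL (addrK _) E) mulrAC -[in RHS](mulrA (q ^+ _)) -exprSr.
by rewrite mulrBr mulr1 mulfK.
Qed.

(** * Inversion of the convolution by signed sums over compositions *)

Lemma triangular_exchange (V : nmodType) (G : nat -> nat -> V) N :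
  \sum_(i < N.+1) \sum_(k < (N - i).+1) G i k =
  \sum_(m < N.+1) \sum_(i < m.+1) G i (m - i)%N.
Proof.
elim: N => [|N IH]; first by rewrite !big_ord1.
(* Passing from [N] to [N + 1] adds the antidiagonal [i + k = N + 1]: the last term of each inner
   sum on the left. *)
rewrite big_ord_recr [RHS]big_ord_recr /= -IH subnn big_ord1.
rewrite [X in _ = _ + X]big_ord_recr /= subnn addrA; congr (_ + _).
rewrite -big_split; apply: eq_bigr => i _ /=.
by rewrite subSn ?big_ord_recr // -ltnS.
Qed.

Section Inversion.
Variable R : comNzRingType.

Definition composition_coef (p : nat -> R) (i : nat) : R :=
  \sum_(j \in compositions i) (-1) ^+ size j * \prod_(k <- j) p k.

Lemma composition_coefE p i : composition_coef p i =
  \sum_(j <- fset_set (compositions i)) (-1) ^+ size j * \prod_(k <- j) p k.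
Proof. by rewrite /composition_coef fsbig_finite //; exact: finite_compositions. Qed.

Lemma composition_coef0 p : composition_coef p 0 = 1.
Proof.
rewrite /composition_coef (_ : compositions 0 = [set [::]]%classic).
  by rewrite fsbig_set1 big_nil mulr1.
apply/seteqP; split=> [[|k j] [jpos]|_ ->] //=.
move/eqP; rewrite addn_eq0 => /andP[/eqP k0 _].
by have := jpos k (mem_head _ _); rewrite k0.
Qed.

(** Classify compositions by their first part [k + 1]; removing it leaves a composition of [i - k]
    and flips the sign. *)
Lemma composition_coefS p i : composition_coef p i.+1 =
  - \sum_(k < i.+1) p k.+1 * composition_coef p (i - k).
Proof.
rewrite composition_coefE.
(* A composition of [i + 1] is nonempty with first part between 1 and [i + 1], so neither the
   default of [head] nor that of [inord] is reached. *)
rewrite big_seq (partition_big (fun j => inord (head 0 j).-1 : 'I_i.+1) predT) //=.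
rewrite -sumrN; apply: eq_bigr => k _.
rewrite composition_coefE -mulNr mulr_sumr.
rewrite -big_filter.
have P j l := mem_fset_setP j (finite_compositions l).
transitivity (\sum_(j <- map (cons k.+1) (fset_set (compositions (i - k))))
   (-1) ^+ size j * \prod_(l <- j) p l); last first.
  by rewrite big_map; apply: eq_bigr => j _; rewrite big_cons exprS mulN1r !mulNr mulrCA.
apply: perm_big; apply: uniq_perm.
- by rewrite filter_uniq ?fset_uniq.
- by rewrite map_inj_uniq ?fset_uniq // => j l [].
move=> j; rewrite mem_filter -andbA andbCA andbb.
apply/andP/mapP => [[/eqP jk /P[]]|[l /P[lpos lsum] ->]].
  case: j jk => [|l j] //= jk jpos jsum.
  have l0 := jpos l (mem_head _ _).
  have lE : l = k.+1.
    rewrite -jk /= inordK ?prednK //.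
    by rewrite -jsum -(leq_add2r (sumn j)) leq_addr.
  exists j; rewrite ?lE //; apply/P; split; last first.
    by have := congr1 (subn^~ k.+1) jsum; rewrite lE addKn subSS.
  by move=> a aj; apply: jpos; rewrite inE aj orbT.
split; first by rewrite /= inord_val.
apply/P; split=> /= [a|]; last by rewrite lsum addSn subnKC // -ltnS.
by rewrite inE => /orP[/eqP->//|/lpos].
Qed.

Lemma composition_coef_conv p m : p 0 = 1 ->
  \sum_(i < m.+1) composition_coef p i * p (m - i)%N = (m == 0%N)%:R.
Proof.
move=> p0; rewrite big_ord_recr /= subnn p0 mulr1.
case: m => [|m]; first by rewrite big_ord0 add0r composition_coef0.
(* Read backwards, the convolution without its last term is the sum in the recursion, so the two
   cancel. *)
rewrite composition_coefS (reindex_inj rev_ord_inj) /=.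
apply/eqP; rewrite subr_eq0; apply/eqP; apply: eq_bigr => i _.
by rewrite subKn ?ltn_ord // subSS mulrC.
Qed.

(** Expand the delta sequence as the convolution of [composition_coef p] with [p], then regroup so
    that [p] and [S] recombine into [P]. *)
Lemma composition_inversion (p P S : nat -> R) s n : (0 < s)%N -> p 0 = 1 ->
  (forall m, P m = \sum_(i < (m %/ s).+1) p i * S (m - i * s)%N) ->
  S n = \sum_(i < (n %/ s).+1) composition_coef p i * P (n - i * s)%N.
Proof.
move=> s0 p0 PE; set N := (n %/ s)%N.
transitivity (\sum_(m < N.+1) (m == 0 :> nat)%:R * S (n - m * s)%N).
  rewrite big_ord_recl mul1r mul0n subn0 big1 ?addr0 // => i _.
  by rewrite mul0r.
transitivity (\sum_(i < N.+1) \sum_(k < (N - i).+1)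
    composition_coef p i * p k * S (n - (i + k) * s)%N).
  rewrite (triangular_exchange (fun i k =>
    composition_coef p i * p k * S (n - (i + k) * s)%N)).
  apply: eq_bigr => m _; rewrite -(composition_coef_conv m p0) mulr_suml.
  by apply: eq_bigr => i _; rewrite subnKC // -ltnS.
(* The quotient of [n - i * s] by [s] is [N - i], so the two ranges agree. *)
apply: eq_bigr => i _; rewrite PE divnBMl mulr_sumr; apply: eq_bigr => k _.
by rewrite mulrA mulnDl subnDA.
Qed.
End Inversion.

Theorem theorem5p1 (r s n q : nat) (F : finFieldType)
    (hr : (1 <= r)%N) (hs : (2 <= s)%N) (hq : #|F| = q) :
  (numS F r n s)%:R =
    \sum_(0 <= i < (n %/ s).+1) \sum_(j \in compositions i)
      (-1) ^+ size j * (\prod_(k <- j) Pval q r k) * Pval q r (n - i * s)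
  /\
  (numQ F r n s)%:R =
    - \sum_(1 <= i < (n %/ s).+1) \sum_(j \in compositions i)
      (-1) ^+ size j * (\prod_(k <- j) Pval q r k) * Pval q r (n - i * s).
Proof.
have s0 : (0 < s)%N := ltnW hs.
have PE m : (numP F r m)%:R = Pval q r m by rewrite -hq numP_Pval.
have P0 : Pval q r 0 = 1.
  have q1 : 1 - q%:R^-1 != 0 :> rat.
    by rewrite subr_eq0 eq_sym invr_eq1 pnatr_eq1 -hq gtn_eqF ?card_finNzRing_gt1.
  by rewrite /Pval !addn0 !binn subnn expr0 expr1 mul1r divff.
have conv m : Pval q r m =
    \sum_(i < (m %/ s).+1) Pval q r i * (numS F r (m - i * s) s)%:R.
  rewrite -PE (numP_conv F r m s0) natr_sum.
  by apply: eq_bigr => i _; rewrite natrM PE.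
have inner i : \sum_(j \in compositions i)
    (-1) ^+ size j * (\prod_(k <- j) Pval q r k) * Pval q r (n - i * s) =
    composition_coef (Pval q r) i * Pval q r (n - i * s).
  by rewrite composition_coefE fsbig_finite ?mulr_suml //; exact: finite_compositions.
have SE : (numS F r n s)%:R = \sum_(0 <= i < (n %/ s).+1)
    composition_coef (Pval q r) i * Pval q r (n - i * s).
  rewrite big_mkord.
  exact: (composition_inversion (S := fun m => (numS F r m s)%:R) n s0 P0 conv).
split; first by rewrite SE; apply: eq_bigr => i _; rewrite inner.
have -> : (numQ F r n s)%:R = Pval q r n - (numS F r n s)%:R.
  by rewrite -PE (numPQS F r n s) natrD addrK.
(* The term [i = 0] comes from the empty composition and equals [Pval q r n]; it cancels in the
   difference. *)
rewrite SE big_ltn // composition_coef0 mul1r subn0 opprD addNKr.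
by congr (- _); apply: eq_bigr => i _; rewrite inner.
Qed.
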